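(* Let $X$ and $Y$ be set-valued mappings. Then $$\mathbf{m}(X|\mathcal{H})+\mathbf{m}(Y|\mathcal{H})\subset\mathbf{m}(X+Y|\mathcal{H}).$$
   Context: $\mathfrak{X}$ is a separable real Banach space with Borel $\sigma$-algebra $\mathcal{B}(\mathfrak{X})$; $(\Omega,\mathcal{F},\mathbf{P})$ is a complete probability space and $\mathcal{H}$ is a sub-$\sigma$-algebra of $\mathcal{F}$. Set-valued mappings are maps $\omega\mapsto X(\omega)\subset\mathfrak{X}$ from $\Omega$ to the family of all subsets of $\mathfrak{X}$. An $\mathcal{H}$-measurable random set is a set-valued mapping whose graph $\{(\omega,x)\in\Omega\times\mathfrak{X}:\ x\in X(\omega)\}$ belongs to $\mathcal{H}\otimes\mathcal{B}(\mathfrak{X})$. For any set-valued mapping $X$, the conditional core $\mathbf{m}(X|\mathcal{H})$ is the largest $\mathcal{H}$-measurable random set $X'$ such that $X'\subset X$ a.s.; it may be empty. The sum is pointwise: $A+B=\{x+y:\ x\in A,\ y\in B\}$ for $A,B\subset\mathfrak{X}$ (so it is empty if $A$ or $B$ is empty), applied for each $\omega$. *)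

(* Defs.v *)
From HB Require Import structures.
From mathcomp Require Import all_boot all_order all_algebra.
From mathcomp Require Import all_classical all_reals all_analysis.
Import Order.TTheory GRing.Theory Num.Theory.
Import numFieldNormedType.Exports.

Set Implicit Arguments.
Unset Strict Implicit.
Unset Printing Implicit Defensive.

Local Open Scope classical_set_scope.
Local Open Scope ring_scope.

Definition separable (V : topologicalType) : Prop :=
  exists2 D : set V, countable D & dense D.

Definition sub_sigma_algebra_of (d : measure_display) (T : measurableType d)
    (H : set (set T)) : Prop :=
  sigma_algebra setT H /\ H `<=` measurable.

Definition set_graph (T V : Type) (X : T -> set V) : set (T * V) :=
  [set p | X p.1 p.2].

(* The product sigma-algebra is that of the product type of Omega equipped with
   <<s H >> (which is H itself when H is a sigma-algebra) and V equipped with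
   its Borel sigma-algebra. *)
Definition random_set (R : realType) (V : normedModType R)
    (d : measure_display) (T : measurableType d) (H : set (set T))
    (X : T -> set V) : Prop :=
  @measurable _ (g_sigma_algebraType H * g_sigma_algebraType (@open V))%type
    (set_graph X).

Definition as_subset (R : realType) (V : Type) (d : measure_display)
    (T : measurableType d) (P : probability T R) (X Y : T -> set V) : Prop :=
  {ae P, forall w, X w `<=` Y w}.

(* The largest element for almost sure inclusion is only unique up to almost
   sure equality, and need not exist for an arbitrary X; hence a predicate
   "M is a version of m(X|H)" rather than a function of X. *)
Definition is_conditional_core (R : realType) (V : normedModType R)
    (d : measure_display) (T : measurableType d) (P : probability T R)
    (H : set (set T)) (X M : T -> set V) : Prop :=
  [/\ random_set H M, as_subset P M X &
      forall M' : T -> set V,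
        random_set H M' -> as_subset P M' X -> as_subset P M' M].

Definition set_sum (V : zmodType) (A B : set V) : set V :=
  [set x + y | x in A & y in B].

(* Main.v *)
Require Import Defs.
From mathcomp Require Import all_boot all_order all_algebra.
From mathcomp Require Import all_classical all_reals all_analysis.
Import Order.TTheory GRing.Theory Num.Theory.
Import numFieldNormedType.Exports.

Set Implicit Arguments.
Unset Strict Implicit.
Unset Printing Implicit Defensive.

Local Open Scope classical_set_scope.
Local Open Scope ring_scope.

(** The sum M of the two cores mX and mY is almost surely contained in X + Y, so
    maximality of mXY would settle the matter if M were a random set. But the
    graph of M is the image of a measurable set under (w, x, y) |-> (w, x + y),
    and such an image is in general only analytic. So M is tested from inside: if M is
    not almost surely contained in mXY, it suffices to find a random set L whose
    values are contained in M w minus mXY w and are nonempty with positive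
    probability. Such an L is almost surely contained in X + Y, hence in mXY, hence
    almost surely empty: a contradiction.

    To construct L, let A w be the set of pairs (x, y) in mX w * mY w with
    x + y outside mXY w. Its graph is measurable in T * (V * V), and measurable
    sets are Souslin sets over the rectangles with a closed second factor
    (measurable_souslin). The argument of Choquet's capacitability theorem
    (souslin_capacity) then yields a decreasing sequence of measurable
    closed-valued maps D n, with D n w covered by finitely many balls of radius
    1 / (n + 1), whose intersection K w is contained in A w and is nonempty with
    positive probability. This is where completeness and separability of V are
    used: they make K w compact, and nonempty as soon as every D n w is.

    Finally L w := {x + y : (x, y) in K w}. Images of compact sets behave well:
    L w is the intersection over n of the closures of {x + y : (x, y) in D n w}
    (image_bigcap_closure), and each of these closures depends measurably on w.

    Everything measurable takes place over the sub-sigma-algebra H: the base space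
    is T equipped with H, and the measure is the restriction of P to H. *)

(** * Closed-valued maps with countably many values *)

Lemma nested_subset (X : Type) (D : nat -> set X) :
  (forall n, D n.+1 `<=` D n) -> forall m n, (m <= n)%N -> D n `<=` D m.
Proof.
move=> DS; apply: (@homo_leq _ D (fun A B => B `<=` A)); last exact: DS.
  by move=> A.
by move=> B A C AB BC; exact: subset_trans BC AB.
Qed.

Section simple_closed.
Context d (T : measurableType d) (W : topologicalType).

(** These maps play the part of the finite unions of measurable rectangles with
    a closed second factor. Describing them by the measurable partition on which
    they are constant makes every set of the form {w : Q (D w)} measurable,
    whatever Q is; in particular the set where D w is nonempty. *)
Definition simple_closed (D : T -> set W) : Prop :=
  exists (I : countType) (phi : T -> I) (F : I -> set W),
    [/\ forall i, measurable (phi @^-1` [set i]),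
        forall i, closed (F i) &
        forall w, D w = F (phi w)].

Lemma simple_closed_cst (F : set W) : closed F -> simple_closed (fun=> F).
Proof.
move=> cF; exists unit, (fun=> tt), (fun=> F); split=> // -[].
by rewrite (_ : _ @^-1` _ = setT) // -subTset => w.
Qed.

Lemma simple_closed_op (op : set W -> set W -> set W) (D E : T -> set W) :
  (forall F G, closed F -> closed G -> closed (op F G)) ->
  simple_closed D -> simple_closed E -> simple_closed (fun w => op (D w) (E w)).
Proof.
move=> clop [I [f [F [mf cF DF]]]] [J [g [G [mg cG EG]]]].
exists (I * J)%type, (fun w => (f w, g w)), (fun ij => op (F ij.1) (G ij.2)).
split=> [[i j]|[i j]|w] /=; [|exact: clop|by rewrite DF EG].
rewrite (_ : _ @^-1` _ = f @^-1` [set i] `&` g @^-1` [set j]).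
  exact: measurableI.
by apply/seteqP; split=> w /= [-> ->].
Qed.

Lemma simple_closed_bigop (op : set W -> set W -> set W) (D : nat -> T -> set W)
    (E : nat -> T -> set W) :
  (forall F G, closed F -> closed G -> closed (op F G)) ->
  simple_closed (E 0%N) -> (forall n, simple_closed (D n)) ->
  (forall n w, E n.+1 w = op (E n w) (D n w)) ->
  forall n, simple_closed (E n).
Proof.
move=> clop E0 sD ES; elim=> // n IH.
rewrite (_ : E n.+1 = fun w => op (E n w) (D n w)); last exact/funext/ES.
exact: simple_closed_op.
Qed.

Lemma simple_closed_bigcup n (D : nat -> T -> set W) :
  (forall i, simple_closed (D i)) ->
  simple_closed (fun w => \bigcup_(i < n) D i w).
Proof.
move=> sD; apply: (@simple_closed_bigop setU D
  (fun n w => \bigcup_(i < n) D i w)) => //.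
- by move=> F G; exact: closedU.
- rewrite (_ : (fun _ => _) = fun=> set0); first exact/simple_closed_cst/closed0.
  by apply/funext => w; apply: bigcup0.
- by move=> m w; rewrite IIS bigcup_setU bigcup_set1.
Qed.

Lemma simple_closed_bigcap n (D : nat -> T -> set W) :
  (forall i, simple_closed (D i)) ->
  simple_closed (fun w => \bigcap_(i < n) D i w).
Proof.
move=> sD; apply: (@simple_closed_bigop setI D
  (fun n w => \bigcap_(i < n) D i w)) => //.
- by move=> F G; exact: closedI.
- rewrite (_ : (fun _ => _) = fun=> setT); first exact/simple_closed_cst/closedT.
  by apply/funext => w; rewrite -subTset => u _ i.
- by move=> m w; rewrite IIS bigcap_setU bigcap_set1.
Qed.

Lemma measurable_simple_closed (Q : set W -> Prop) (D : T -> set W) :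
  simple_closed D -> measurable [set w | Q (D w)].
Proof.
move=> [I [f [F [mf _ DF]]]].
rewrite (_ : mkset _ = \bigcup_(i in [set i | Q (F i)]) f @^-1` [set i]).
  rewrite bigcup_mkcond; apply: countable_bigcupT_measurable => [|i].
    exact: countableP.
  by case: ifP.
apply/seteqP; split=> w /=; rewrite DF; first by exists (f w).
by move=> [i Qi /= ->].
Qed.

Lemma measurable_graph_simple_closed d' (U : measurableType d')
    (G : set W -> set U) (D : T -> set W) :
  (forall F, closed F -> measurable (G F)) -> simple_closed D ->
  measurable [set p : T * U | G (D p.1) p.2].
Proof.
move=> mG [I [f [F [mf cF DF]]]].
rewrite (_ : mkset _ = \bigcup_i (f @^-1` [set i] `*` G (F i))).
  apply: countable_bigcupT_measurable => [|i]; first exact: countableP.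
  by apply: measurableX => //; exact: mG.
apply/seteqP; split=> -[w u] /=; rewrite DF; first by exists (f w).
by move=> [i _ [/= ->]].
Qed.

End simple_closed.

(** * Souslin set-valued maps *)

Section souslin.
Context d (T : measurableType d) (W : topologicalType).

Definition bounded_part (A : T -> set W) (c : nat -> T -> W -> nat)
    (k : nat -> nat) (N : nat) (w : T) : set W :=
  [set u | A w u /\ forall i, (i < N)%N -> (c i w u <= k i)%N].

(** A Souslin set is presented by a sequence of countable covers, the members of
    the i-th cover being the level sets of c i. Bounding every index by k leaves
    finitely many members of each cover, and such a bounded part must be enclosed
    in A by closed-valued maps. For the result of a Souslin operation, c i reads
    the i-th entry of a branch through the point, and the enclosure is Koenig's
    lemma. Compared with Souslin schemes, this form needs no coding of finite
    sequences in the proofs of stability under countable operations. *)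
Definition souslin_by (A : T -> set W) (c : nat -> T -> W -> nat) : Prop :=
  forall k, exists D : nat -> T -> set W,
    [/\ forall n, simple_closed (D n),
        forall n w, D n.+1 w `<=` D n w,
        forall n, exists N, forall w, bounded_part A c k N w `<=` D n w &
        forall w, \bigcap_n D n w `<=` A w].

Definition souslin (A : T -> set W) : Prop := exists c, souslin_by A c.

(** The enclosing maps may be replaced by their finite intersections, hence
    monotonicity need not be checked. *)
Lemma souslin_by_decreasing (A : T -> set W) (c : nat -> T -> W -> nat) :
  (forall k, exists D : nat -> T -> set W,
    [/\ forall n, simple_closed (D n),
        forall n, exists N, forall w, bounded_part A c k N w `<=` D n w &
        forall w, \bigcap_n D n w `<=` A w]) ->
  souslin_by A c.
Proof.
move=> h k; have [D [sD BD DA]] := h k.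
exists (fun n w => \bigcap_(i < n.+1) D i w); split.
- by move=> n; exact: simple_closed_bigcap.
- by move=> n w u Du i /= ni; apply: Du => /=; exact: ltnW.
- have [N BN] := choice BD.
  move=> n; exists (\max_(i < n.+1) N i)%N => w u [Au cu] i /= ni.
  apply: BN; split=> // j jN; apply: cu; apply: leq_trans jN _.
  exact: (leq_bigmax (Ordinal ni)).
- by move=> w u Du; apply: DA => n _; apply: (Du n I n) => /=.
Qed.

Lemma souslin_closed (A : T -> set W) : simple_closed A -> souslin A.
Proof.
move=> sA; exists (fun _ _ _ => 0%N); apply: souslin_by_decreasing => k.
exists (fun=> A); split=> // [n|w u]; first by exists 0%N => w u [].
by move=> /(_ 0%N I).
Qed.

(** The covers of all the A j together, enumerated through pairs (j, n). *)
Lemma souslin_bigcap (A : nat -> T -> set W) :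
  (forall j, souslin (A j)) -> souslin (fun w => \bigcap_j A j w).
Proof.
move=> /choice[c Ac].
exists (fun m w u => if unpickle m is Some (j, n) then c j n w u else 0%N).
apply: souslin_by_decreasing => k.
have /choice[D DP] := fun j : nat => Ac j (fun n : nat => k (pickle (j, n))).
exists (fun m => if unpickle m is Some (j, n) then D j n else fun=> setT); split.
- move=> m; case: unpickle => [[j n]|]; first by have [] := DP j.
  exact/simple_closed_cst/closedT.
- move=> m; case: unpickle => [[j n]|]; last by exists 0%N.
  have [_ _ /(_ n)[N BN] _] := DP j.
  exists (\max_(i < N) (pickle (j, i : nat)).+1)%N => w u [Au cu].
  apply: BN; split=> [|i iN]; first exact: Au.
  have := cu (pickle (j, i)); rewrite pickleK; apply.
  exact: (leq_bigmax (Ordinal iN)).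
- move=> w u Du j _; have [_ _ _] := DP j; apply => n _.
  by have := Du (pickle (j, n)) I; rewrite pickleK.
Qed.

(** The first cover records which A j contains the point, and the others are
    those of that A j; a bound on the first index leaves finitely many j. *)
Lemma souslin_bigcup (A : nat -> T -> set W) :
  (forall j, souslin (A j)) -> souslin (fun w => \bigcup_j A j w).
Proof.
move=> /choice[c Ac].
have /choice[J JP] (p : T * W) :
    exists j, (\bigcup_i A i p.1) p.2 -> A j p.1 p.2.
  have [[j _ Aj]|nA] := pselect ((\bigcup_i A i p.1) p.2); first by exists j.
  by exists 0%N => /nA.
exists (fun m w u => if m is n.+1 then c (J (w, u)) n w u else J (w, u)).
move=> k; have /choice[D DP] := fun j => Ac j (k \o succn).
have leD j m n w : (m <= n)%N -> D j n w `<=` D j m w.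
  have [_ DS _ _] := DP j.
  by move=> mn; apply: (@nested_subset _ (fun i => D j i w)).
exists (fun n w => \bigcup_(j < (k 0%N).+1) D j n w); split.
- move=> n; apply: (@simple_closed_bigcup _ _ _ _ (D^~ n)) => j.
  by have [] := DP j.
- by move=> n w u [j jk Du]; exists j => //; have [_ DS _ _] := DP j; exact: DS.
- move=> n; have /choice[N BN] j : exists N, forall w,
      bounded_part (A j) (c j) (k \o succn) N w `<=` D j n w.
    by have [_ _ /(_ n)] := DP j.
  exists (\max_(j < (k 0%N).+1) N j).+1 => w u [Au cu].
  have Jk : (J (w, u) < (k 0%N).+1)%N by exact: (cu 0%N).
  exists (J (w, u)) => //; apply: BN; split=> [|i iN]; first exact: (JP (w, u)).
  apply: (cu i.+1); rewrite ltnS; apply: leq_trans iN _.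
  exact: (leq_bigmax (Ordinal Jk)).
- move=> w u Du.
  (* The sets decrease in n and j is bounded, so one j works for all n. *)
  have [[j jD]|nj] := pselect (exists j, forall n, D j n w u).
    by exists j => //; have [_ _ _] := DP j; apply => n _.
  have /choice[n nD] j : exists n, ~ D j n w u.
    by apply/existsNP => jD; apply: nj; exists j.
  have [j /= jk Dj] := Du (\max_(j < (k 0%N).+1) n j)%N I.
  by case: (nD j); apply: leD Dj; exact: (leq_bigmax (Ordinal jk)).
Qed.

End souslin.

(** * Measurable sets are Souslin *)

Section measurable_souslin.
Context d (T : measurableType d) (W : topologicalType).

(** Souslin sets are not stable under complement, but the sets that are Souslin
    together with their complement form a sigma-algebra. *)
Definition bisouslin (A : T -> set W) : Prop :=
  souslin A /\ souslin (fun w => ~` A w).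

Lemma bisouslinC (A : T -> set W) :
  bisouslin A -> bisouslin (fun w => ~` A w).
Proof.
move=> [sA sCA]; split=> //.
by rewrite (_ : (fun _ => _) = A) //; apply/funext => w; rewrite setCK.
Qed.

Lemma bisouslin_bigcup (A : nat -> T -> set W) :
  (forall n, bisouslin (A n)) -> bisouslin (fun w => \bigcup_n A n w).
Proof.
move=> sA; split; first by apply: souslin_bigcup => n; have [] := sA n.
rewrite (_ : (fun _ => _) = fun w => \bigcap_n ~` A n w).
  by apply: (@souslin_bigcap _ _ _ (fun n w => ~` A n w)) => n; have [] := sA n.
by apply/funext => w; rewrite setC_bigcup.
Qed.

Lemma sigma_algebra_bisouslin (X : Type) (h : T -> W -> X) :
  sigma_algebra [set: X] [set B | bisouslin (fun w => h w @^-1` B)].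
Proof.
split=> /= [|B|B].
- under eq_fun do rewrite preimage_set0.
  by split; apply/souslin_closed/simple_closed_cst;
    rewrite ?setC0; [exact: closed0|exact: closedT].
- by rewrite setTD; exact: bisouslinC.
- move/bisouslin_bigcup.
  by under eq_fun do rewrite -preimage_bigcup.
Qed.

Lemma simple_closed_set (A : set T) :
  measurable A -> simple_closed (fun w => [set _ : W | A w]).
Proof.
move=> mA.
exists bool, (fun w => `[< A w >]), (fun b : bool => [set _ | b]); split.
- have E : (fun w => `[< A w >]) @^-1` [set true] = A.
    by apply/seteqP; split=> w /= => [/asboolP|/asboolP].
  move=> [|]; first by rewrite E.
  rewrite (_ : _ @^-1` _ = ~` A); first exact: measurableC.
  by apply/seteqP; split=> w /=; case: asboolP.
- move=> [|].
    rewrite (_ : mkset _ = setT); first exact: closedT.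
    by rewrite -subTset => u.
  rewrite (_ : mkset _ = set0); first exact: closed0.
  by rewrite -subset0 => u.
- by move=> w; apply/seteqP; split=> u /= /asboolP.
Qed.

(** Needed because the open sets generate the Borel sets, whereas the sets known
    to be Souslin at the outset are closed. *)
Lemma open_bigcup_closed (R : realType) (V : normedModType R) (O : set V) :
  open O ->
  exists F : nat -> set V, (forall n, closed (F n)) /\ O = \bigcup_n F n.
Proof.
move=> oO; exists (fun n => [set v | ball v n.+1%:R^-1 `<=` O]); split.
  move=> n v clv u; set r := n.+1%:R^-1 => vu.
  have : nbhs v (ball u r).
    by apply: open_nbhs_nbhs; split; [exact: ball_open|exact: ball_sym].
  by move=> /clv[v' [v'O /ball_sym/v'O]].
apply/seteqP; split=> v; last by move=> [n _]; apply; exact: ballxx.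
move=> /(conj oO)/open_nbhs_nbhs/nbhs_ballP[e /= e0 eO].
have [N _ /(_ N (leqnn N)) Ne] := near_infty_natSinv_lt (PosNum e0).
by exists N => // u /(le_ball (ltW Ne)) /eO.
Qed.

(** The map g moves random sets of V to a single space W, so that conditions on
    x, on y and on x + y become conditions on the pair (x, y). *)
Lemma measurable_souslin (R : realType) (V : normedModType R) (g : W -> V)
    (B : set (T * V)) : continuous g ->
  @measurable _ (T * g_sigma_algebraType (@open V))%type B ->
  souslin (fun w => [set u | B (w, g u)]).
Proof.
move=> cg; suff : @measurable _ (T * g_sigma_algebraType (@open V))%type `<=`
    [set B | bisouslin (fun w => (fun u => (w, g u)) @^-1` B)] by move=> h /h[].
apply: smallest_sub; first exact: sigma_algebra_bisouslin.
move=> _ [[A mA <-]|[A mA <-]]; rewrite setTI.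
  split; apply/souslin_closed; first exact: (simple_closed_set mA).
  exact: (simple_closed_set (measurableC mA)).
suff : <<s @open V >> `<=` [set A | bisouslin (fun _ : T => g @^-1` A)] by apply.
apply: smallest_sub; first exact: (sigma_algebra_bisouslin (fun=> g)).
move=> O oO /=; split.
  have [F [cF ->]] := open_bigcup_closed oO; rewrite preimage_bigcup.
  apply: souslin_bigcup => n; apply/souslin_closed/simple_closed_cst.
  by apply: preimage_closed => // ? _; exact: cg.
apply/souslin_closed/simple_closed_cst.
by apply: open_closedC; apply: open_comp => // ? _; exact: cg.
Qed.

End measurable_souslin.

(** * Nested closed sets in a complete space *)

Section compactness.
Context (R : realType) (W : pseudoMetricType R).

(** Completeness as a property of W, so that it can be proved for the product of
    two complete spaces. *)
Definition cauchy_complete : Prop :=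
  forall F : set_system W, ProperFilter F -> cauchy_ex F -> exists u : W, F --> u.

Definition finitely_covered (r : R) (K : set W) : Prop :=
  exists (m : nat) (x : nat -> W), K `<=` \bigcup_(j < m) ball (x j) r.

Lemma ultra_bigcup (I : Type) (U : set_system I) (m : nat) (B : nat -> set I) :
  UltraFilter U -> U (\bigcup_(j < m) B j) -> exists j, U (B j).
Proof.
move=> UU; elim: m => [|m IH].
  rewrite (_ : `I_0 = set0); last by rewrite -subset0.
  by rewrite bigcup_set0 => /filter_not_empty.
rewrite IIS bigcup_setU bigcup_set1 => Um.
have [|UC] := in_ultra_setVsetC (\bigcup_(j < m) B j) UU; first exact: IH.
exists m; apply: filterS (filterI Um UC) => u [[//|//]].
Qed.

(** Cantor's intersection theorem with total boundedness in place of shrinking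
    diameters: an ultrafilter containing all the D n contains one of the balls
    covering D n, for each n, so it is Cauchy; its limit lies in every D n. *)
Lemma nested_closed_nonempty (D : nat -> set W) :
  cauchy_complete ->
  (forall n, closed (D n)) -> (forall n, D n.+1 `<=` D n) ->
  (forall n, D n !=set0) ->
  (forall n, finitely_covered n.+1%:R^-1 (D n)) ->
  \bigcap_n D n !=set0.
Proof.
move=> cW cD DS D0 fD.
have leD := nested_subset DS.
pose F := filter_from setT D.
have PF : ProperFilter F.
  apply: filter_from_proper => [|n _]; last exact: D0.
  apply: filter_from_filter; first by exists 0%N.
  move=> i j _ _; exists (maxn i j) => // u Du.
  by split; apply: leD Du; rewrite ?leq_maxl ?leq_maxr.
have [U [UU FU]] := ultraFilterLemma PF.
have UD n : U (D n) by apply: FU; exists n.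
have [u Uu] : exists u : W, U --> u.
  apply: cW => e e0.
  have [N _ /(_ N (leqnn N)) Ne] := near_infty_natSinv_lt (PosNum e0).
  have [m [x DN]] := fD N.
  have [j Uj] := ultra_bigcup UU (filterS DN (UD N)).
  by exists (x j); apply: filterS Uj; exact/le_ball/ltW.
exists u => n _; apply: cD => B /Uu UB.
exact: filter_ex (filterI (UD n) UB).
Qed.

End compactness.

(** * Capacitability *)

Section outer.
Context d (T : measurableType d) (R : realType).
Variable mu : {finite_measure set T -> \bar R}.

(** The outer measure of S is at most e, in the form where the infimum that
    defines the outer measure is attained. *)
Definition outer_le (e : \bar R) (S : set T) : Prop :=
  exists B, [/\ measurable B, S `<=` B & (mu B <= e)%E].

Lemma outer_leS (e : \bar R) (S S' : set T) :
  S `<=` S' -> outer_le e S' -> outer_le e S.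
Proof. by move=> SS' [B [mB S'B Be]]; exists B; split=> // w /SS' /S'B. Qed.

(** Continuity from below of the outer measure on arbitrary sets: replacing the
    measurable hulls B n by the intersections of the B m with m >= n makes them
    increase with n. *)
Lemma outer_le_bigcup (e : \bar R) (S : nat -> set T) :
  (forall n, S n `<=` S n.+1) -> (forall n, outer_le e (S n)) ->
  outer_le e (\bigcup_n S n).
Proof.
move=> ndS /choice[B BP].
have leS m n : (m <= n)%N -> S m `<=` S n.
  by apply: (@homo_leq _ S subset); [move=> A|exact: subset_trans|exact: ndS].
pose C n := \bigcap_(m in [set m | (n <= m)%N]) B m.
have mB n : measurable (B n) by have [] := BP n.
have mC n : measurable (C n).
  by apply: bigcap_measurable => [|m _]; [exists n => /=|].
exists (\bigcup_n C n); split.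
- exact: bigcup_measurable.
- move=> w [n _ Sw]; exists n => // m /= nm.
  by have [_ + _] := BP m; apply; exact: leS Sw.
- have cC : mu \o C @ \oo --> mu (\bigcup_n C n).
    apply: nondecreasing_cvg_mu => //; first exact: bigcup_measurable.
    apply/nondecreasing_seqP => n; apply/subsetPset => w Cw m /= nm.
    by apply: Cw => /=; exact: ltnW.
  rewrite -(cvg_lim _ cC)//; apply: lime_le.
    by apply/cvg_ex; eexists; exact: cC.
  apply: nearW => n /=; have [_ _ Be] := BP n.
  by apply: le_trans Be; apply: le_measure; rewrite ?inE// => w; apply => /=.
Qed.

Lemma outer_le_negligible (S : set T) :
  (forall e : R, 0 < e -> outer_le e%:E S) -> mu.-negligible S.
Proof.
move=> h; have /choice[B BP] (n : nat) := h n.+1%:R^-1 ltac:(by []).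
exists (\bigcap_n B n); split.
- by apply: bigcap_measurable => [|n _]; [exists 0%N|have [] := BP n].
- apply/eqP; rewrite eq_le measure_ge0 andbT; apply/lee_addgt0Pr => e e0.
  have [N _ /(_ N (leqnn N)) Ne] := near_infty_natSinv_lt (PosNum e0).
  rewrite add0e; have [mB _ BN] := BP N.
  apply: (@le_trans _ _ (mu (B N))); last by rewrite (le_trans BN)// lee_fin ltW.
  apply: le_measure; rewrite ?inE//; last by move=> w; apply.
  by apply: bigcap_measurable => [|n _]; [exists 0%N|have [] := BP n].
- by move=> w Sw n _; have [_ + _] := BP n; apply.
Qed.

End outer.

Section capacity.
Context d (T : measurableType d) (R : realType).
Variable mu : {finite_measure set T -> \bar R}.

(** The bounds k 0, k 1, ... are chosen one after the other: bounding one more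
    index by m exhausts the current set as m increases, so by continuity from
    below some m keeps the outer measure of the projection above e. *)
Lemma outer_le_bounded_part (W : topologicalType) (e : \bar R)
    (A : T -> set W) (c : nat -> T -> W -> nat) :
  ~ outer_le mu e [set w | A w !=set0] ->
  exists k : nat -> nat,
    forall N, ~ outer_le mu e [set w | bounded_part A c k N w !=set0].
Proof.
move=> nA.
pose S (s : seq nat) := [set w | bounded_part A c (nth 0%N s) (size s) w !=set0].
have /choice[f fP] s :
    exists m, ~ outer_le mu e (S s) -> ~ outer_le mu e (S (rcons s m)).
  have [h|h] := pselect (exists m, ~ outer_le mu e (S (rcons s m))).
    by have [m hm] := h; exists m.
  exists 0%N => ns; case: ns.
  apply: (@outer_leS _ _ _ mu _ _ (\bigcup_m S (rcons s m))).
    move=> w [u [Au cu]]; exists (c (size s) w u) => //; exists u; split=> // i.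
    rewrite size_rcons nth_rcons ltnS leq_eqVlt => /orP[/eqP->|lti].
      by rewrite ltnn eqxx.
    by rewrite lti; exact: cu.
  apply: outer_le_bigcup => m; last by apply: contrapT => hm; apply: h; exists m.
  move=> w [u [Au cu]]; exists u; split=> // i; move: (cu i).
  rewrite !size_rcons !nth_rcons => + lti; move=> /(_ lti)/leq_trans; apply.
  by case: ifP => // _; case: ifP.
pose t n := iter n (fun s => rcons s (f s)) [::].
have tsize n : size (t n) = n by elim: n => //= n IH; rewrite size_rcons IH.
have tnth n i : (i < n)%N -> nth 0%N (t n) i = f (t i).
  elim: n => // n IH; rewrite ltnS leq_eqVlt /= -/(t n) nth_rcons tsize.
  by move=> /orP[/eqP->|ni]; rewrite ?ltnn ?eqxx// ni IH.
have nt n : ~ outer_le mu e (S (t n)).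
  elim: n => [|n /fP//]; apply: contra_not nA; apply: outer_leS => w [u Au].
  by exists u.
exists (f \o t) => N; apply: contra_not (nt N); apply: outer_leS.
move=> w [u [Au cu]]; exists u; split=> // i iN /=.
by rewrite -(tnth _ _ iN); apply: cu; rewrite tsize.
Qed.

Lemma closure_ball_double (W : pseudoMetricType R) (x : W) (r : R) :
  0 < r -> closure (ball x r) `<=` ball x (r + r).
Proof.
move=> r0 u /(_ _ (nbhsx_ballx u r r0))[v [xv uv]].
exact: ball_triangle xv (ball_sym uv).
Qed.

(** Interleaving the covers of A with covers of W by balls of radius r n centred
    on a dense sequence: a bound on the indices then also leaves finitely many
    balls of each radius. *)
Lemma souslin_finitely_covered (W : pseudoMetricType R) (q : nat -> W)
    (A : T -> set W) :
  (forall u e, 0 < e -> exists n, ball (q n) e u) ->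
  souslin A ->
  exists c : nat -> T -> W -> nat, forall k, exists D : nat -> T -> set W,
    [/\ forall n, simple_closed (D n),
        forall n w, D n.+1 w `<=` D n w,
        forall n, exists N, forall w, bounded_part A c k N w `<=` D n w,
        forall w, \bigcap_n D n w `<=` A w &
        forall n w, finitely_covered n.+1%:R^-1 (D n w)].
Proof.
move=> dq [c Ac].
(* The closure of a ball is only known to lie in the ball of twice the radius. *)
pose r n : R := n.+1%:R^-1 / 2.
have r0 n : 0 < r n by rewrite divr_gt0// invr_gt0.
have /choice[J JP] (p : nat * W) : exists j, ball (q j) (r p.1) p.2.
  exact: dq.
exists (fun i w u => if odd i then J (i./2, u) else c i./2 w u) => k.
have [D [sD DS BD DA]] := Ac (k \o double).
pose K n := \bigcup_(j < (k n.*2.+1).+1) closure (ball (q j) (r n)).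
have cK n : simple_closed (fun _ : T => K n).
  apply: (@simple_closed_bigcup _ _ _ _ (fun j _ => closure (ball (q j) (r n)))).
  by move=> j; exact/simple_closed_cst/closed_closure.
exists (fun n w => D n w `&` \bigcap_(i < n.+1) K i); split.
- move=> n; apply: (@simple_closed_op _ _ _ setI) => //; first exact: closedI.
  exact: (@simple_closed_bigcap _ _ _ _ (fun i _ => K i)).
- move=> n w u [Du Ku]; split; first exact: DS.
  by move=> i /= ni; apply: Ku => /=; exact: ltnW.
- move=> n; have [N BN] := BD n; exists (maxn N.*2 n.+1.*2) => w u [Au cu].
  split.
    apply: BN; split=> // i iN; have := cu i.*2; rewrite odd_double doubleK.
    by apply; rewrite leq_max ltn_double iN.
  move=> i /= ni; exists (J (i, u)); last first.
    by apply: subset_closure; exact: (JP (i, u)).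
  have := cu i.*2.+1; rewrite /= odd_double /= uphalf_double; apply.
  by rewrite leq_max; apply/orP; right; rewrite -doubleS leq_double.
- by move=> w u Du; apply: DA => n _; have [] := Du n I.
- move=> n w; exists (k n.*2.+1).+1, q => u [_ /(_ n (ltnSn n))[j jk ju]].
  by exists j => //; rewrite [n.+1%:R^-1]splitr; exact: closure_ball_double.
Qed.

(** Once the bounds k are fixed, the projection of the intersection of the D n is
    the intersection of their projections, by compactness; these are measurable,
    decreasing and of measure at least e. Continuity from above concludes. *)
Lemma souslin_capacity (W : pseudoMetricType R) (q : nat -> W)
    (A : T -> set W) :
  (forall u e, 0 < e -> exists n, ball (q n) e u) ->
  cauchy_complete W ->
  souslin A -> ~ mu.-negligible [set w | A w !=set0] ->
  exists D : nat -> T -> set W,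
    [/\ forall n, simple_closed (D n),
        forall n w, D n.+1 w `<=` D n w,
        forall n w, finitely_covered n.+1%:R^-1 (D n w),
        forall w, \bigcap_n D n w `<=` A w &
        exists Q, [/\ measurable Q, (0 < mu Q)%E &
          Q `<=` [set w | \bigcap_n D n w !=set0]]].
Proof.
move=> dq cW /(souslin_finitely_covered dq)[c cP] nA.
have [e e0 ne] : exists2 e : R, 0 < e & ~ outer_le mu e%:E [set w | A w !=set0].
  apply: contrapT => h; apply: nA; apply: outer_le_negligible => e e0.
  by apply: contrapT => he; apply: h; exists e.
have [k kP] := outer_le_bounded_part c ne.
have [D [sD DS BD DA fD]] := cP k; exists D; split=> //.
pose Q n := [set w | D n w !=set0].
have mQ n : measurable (Q n) by exact: (@measurable_simple_closed _ _ _ nonempty).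
have eQ n : (e%:E <= mu (Q n))%E.
  rewrite leNgt; apply/negP => /ltW Qe; have [N BN] := BD n; apply: (kP N).
  by exists (Q n); split=> // w [u /BN Du]; exists u.
exists (\bigcap_n Q n); split; first exact: bigcap_measurable; last first.
  move=> w Qw; apply: nested_closed_nonempty => // n; last exact: Qw.
  by have [I [f [F [_ cF ->]]]] := sD n.
have cQ : mu \o Q @ \oo --> mu (\bigcap_n Q n).
  apply: nonincreasing_cvg_mu => //.
  - by rewrite -ge0_fin_numE// fin_num_measure.
  - exact: bigcap_measurable.
  - apply/nonincreasing_seqP => n; apply/subsetPset => w [u Du].
    by exists u; exact: DS.
apply: (@lt_le_trans _ _ e%:E); first by rewrite lte_fin.
rewrite -(cvg_lim _ cQ)//; apply: lime_ge; last exact: nearW.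
by apply/cvg_ex; eexists; exact: cQ.
Qed.

End capacity.

(** * Image of a random compact set *)

(** A point v of the right-hand side has, for each n, a point of D n that g sends
    close to v; compactness gives a common point of the D n that g sends to v. *)
Lemma image_bigcap_closure (R : realType) (W : pseudoMetricType R)
    (V : normedModType R) (g : W -> V) (D : nat -> set W) :
  cauchy_complete W -> continuous g ->
  (forall n, closed (D n)) -> (forall n, D n.+1 `<=` D n) ->
  (forall n, finitely_covered n.+1%:R^-1 (D n)) ->
  g @` (\bigcap_n D n) = \bigcap_n closure (g @` D n).
Proof.
move=> cW cg cD DS fD; apply/seteqP; split=> v.
  by move=> [u Du <-] n _; apply: subset_closure; exists u => //; exact: Du.
move=> clv; pose r n : R := n.+1%:R^-1.
have r0 n : 0 < r n by rewrite invr_gt0.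
pose E n := D n `&` g @^-1` closure (ball v (r n)).
have [u Eu] : \bigcap_n E n !=set0.
  apply: nested_closed_nonempty => // n.
  - apply: closedI => //; apply: preimage_closed; last exact: closed_closure.
    by move=> ? _; exact: cg.
  - move=> u [Du gu]; split; first exact: DS.
    apply: closure_subset gu; apply: le_ball.
    by rewrite lef_pV2 ?posrE// ler_nat.
  - have [_ [[u Du <-] vu]] := clv n I _ (nbhsx_ballx v (r n) (r0 n)).
    by exists u; split=> //; exact: subset_closure.
  - by have [m [x Dx]] := fD n; exists m, x => u [/Dx].
exists u; first by move=> n _; have [] := Eu n I.
apply/esym; apply: contrapT => /eqP; rewrite -subr_eq0 -normr_gt0 => vg.
have h0 : 0 < `|v - g u| / 2 by rewrite divr_gt0.
have [N _ /(_ N (leqnn N)) /= Nh] := near_infty_natSinv_lt (PosNum h0).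
have [_ /(closure_ball_double (r0 N))] := Eu N I.
rewrite -ball_normE /= => /lt_trans /(_ (ltrD Nh Nh)).
by rewrite -splitr ltxx.
Qed.

(** * The product space *)

Section separable_product.
Context (R : realType) (V : completeNormedModType R).

Lemma separable_dense_seq : separable V ->
  exists q : nat -> V, forall u e, 0 < e -> exists n, ball (q n) e u.
Proof.
move=> [S /countable_injP[f inj_f] dS].
have /choice[q qP] n : exists v, forall v', S v' -> f v' = n -> v = v'.
  have [[v' [Sv' fv']]|h] := pselect (exists v', S v' /\ f v' = n).
    by exists v' => v Sv fv; apply: inj_f; rewrite ?inE// fv.
  by exists point => v' Sv' fv'; case: h; exists v'.
exists q => u e e0.
have [v [uv Sv]] := dS _ (ex_intro _ u (ballxx u e0)) (ball_open u e).
by exists (f v); rewrite (qP _ v)//; exact: ball_sym.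
Qed.

Lemma prod_dense_seq : separable V ->
  exists q : nat -> V * V, forall u e, 0 < e -> exists n, ball (q n) e u.
Proof.
move=> /separable_dense_seq[q dq].
exists (fun n => if unpickle n is Some (i, j) then (q i, q j) else point).
move=> [u v] e e0; have [i iu] := dq u e e0; have [j jv] := dq v e e0.
by exists (pickle (i, j)); rewrite pickleK.
Qed.

Lemma prod_cauchy_complete : cauchy_complete (V * V)%type.
Proof.
move=> F PF cF.
have PF1 : ProperFilter (fst @ F) by exact: fmap_proper_filter.
have PF2 : ProperFilter (snd @ F) by exact: fmap_proper_filter.
have [u Fu] : exists u : V, fst @ F --> u.
  apply/cvg_ex; apply: cauchy_cvg; apply: cauchy_exP => e /cF[[x y] Fxy].
  exists x; suff : F (fst @^-1` ball x e) by [].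
  by apply: filterS Fxy => -[a b] [].
have [v Fv] : exists v : V, snd @ F --> v.
  apply/cvg_ex; apply: cauchy_cvg; apply: cauchy_exP => e /cF[[x y] Fxy].
  exists y; suff : F (snd @^-1` ball y e) by [].
  by apply: filterS Fxy => -[a b] [].
exists (u, v) => B /(cvg_pair Fu Fv) FB.
suff : F [set p | B (p.1, p.2)] by apply: filterS => -[].
exact: FB.
Qed.

End separable_product.

(** * The conditional core of a sum *)

Theorem lemma4p7 (R : realType) (V : completeNormedModType R)
    (sepV : separable V)
    (d : measure_display) (T : measurableType d) (P : probability T R)
    (completeP : measure_is_complete P)
    (H : set (set T)) (subH : sub_sigma_algebra_of H)
    (X Y mX mY mXY : T -> set V)
    (coreX : is_conditional_core P H X mX)
    (coreY : is_conditional_core P H Y mY)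
    (coreXY : is_conditional_core P H (fun w => set_sum (X w) (Y w)) mXY) :
  as_subset P (fun w => set_sum (mX w) (mY w)) mXY.
Proof.
have [sH HT] := subH.
have [rX mXX _] := coreX; have [rY mYY _] := coreY.
have [rXY _ maxXY] := coreXY.
pose TH := g_sigma_algebraType H; pose W := (V * V)%type.
have mid : measurable_fun setT (idfun : T -> TH).
  by move=> _ B mB; rewrite setTI; apply: HT; rewrite -(sigma_algebra_id sH).
(* The restriction of P to H, as the law of the identity map from T to TH. *)
pose X0 : {mfun T >-> TH} := mfun_Sub (mem_set mid).
pose mu := distribution P X0.
have negl (S : set T) : mu.-negligible (S : set TH) -> P.-negligible S.
  move=> [N [mN N0 SN]]; exists N; split=> //.
  by apply: HT; rewrite -(sigma_algebra_id sH).
pose g (u : W) := u.1 + u.2.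
have cg : continuous g.
  by move=> u; apply: cvgD; [exact: cvg_fst|exact: cvg_snd].
pose A (w : TH) : set W :=
  [set u | [/\ mX w u.1, mY w u.2 & ~ mXY w (g u)]].
have sA : souslin A.
  pose A3 (n : nat) w : set W := match n with
    | 0 => [set u | mX w u.1] | 1 => [set u | mY w u.2]
    | _ => [set u | ~ mXY w (g u)] end.
  rewrite (_ : A = fun w => \bigcap_n A3 n w); last first.
    apply/funext => w; apply/seteqP; split=> u.
      by move=> [? ? ?] [|[|n]].
    by move=> h; split; [exact: (h 0%N)|exact: (h 1%N)|exact: (h 2%N)].
  apply: souslin_bigcap => -[|[|n]].
  - by apply: (measurable_souslin _ rX) => u; exact: cvg_fst.
  - by apply: (measurable_souslin _ rY) => u; exact: cvg_snd.
  - exact: (measurable_souslin cg (measurableC rXY)).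
have [q dq] := prod_dense_seq sepV.
apply: contrapT => nS.
have nA : ~ mu.-negligible [set w | A w !=set0].
  move=> /negl h; apply: nS; apply: negligibleS h => w /= /existsNP[v].
  by move=> /not_implyP[[x mXx [y mYy <-]] nxy]; exists (x, y).
have [D [sD DS fD DA [Q [mQ Q0 QD]]]] :=
  souslin_capacity dq (@prod_cauchy_complete R V) sA nA.
pose L (w : T) : set V := g @` \bigcap_n D n w.
have cD n w : closed (D n w) by have [I [f [F [_ cF ->]]]] := sD n.
have rL : random_set H L.
  rewrite /random_set (_ : set_graph L = \bigcap_n
      [set p : TH * V | closure (g @` D n p.1) p.2]); last first.
    apply/seteqP; split=> p; rewrite /set_graph/= /L image_bigcap_closure//;
    exact: prod_cauchy_complete.
  apply: bigcap_measurable => [|n _]; first by exists 0%N.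
  apply: (@measurable_graph_simple_closed _ _ _ _ (g_sigma_algebraType (@open V))
    (fun F => closure (g @` F))) => // F _.
  rewrite -[closure _]setCK; apply: measurableC; apply: sub_sigma_algebra.
  exact/closed_openC/closed_closure.
have LXY : as_subset P L (fun w => set_sum (X w) (Y w)).
  apply: filterS2 mXX mYY => w XX YY _ [u /DA[/XX Xu /YY Yu _] <-].
  by exists u.1 => //; exists u.2.
have /negligibleS LmXY := maxXY L rL LXY.
(* Where L w is nonempty it is not contained in mXY w, by the choice of A. *)
have /negligibleP : P.-negligible Q.
  apply: LmXY => w /= /QD[u Du] LXYw; have [_ _] := DA w u Du; apply.
  by apply: LXYw; exists u.
move=> PQ; have : P Q = 0 by apply: PQ; apply: HT; rewrite -(sigma_algebra_id sH).
move: Q0; rewrite /mu /distribution /pushforward /= => /[swap] ->.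
by rewrite ltxx.
Qed.
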